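(* Let $X$ be an Archimedean vector lattice equipped with a complete Hausdorff locally solid convergence structure $\eta$, and let $J$ be an ideal in $X$. Suppose that $(\mathrm{u}\eta)_{|J}=\mathrm{u}(\eta_{|J})$, that is, the operation of taking the unbounded modification commutes with that of taking the restriction to $J$. Then the adherence $\overline{J}^{1}$ of $J$ with respect to $\eta$ is a projection band in $X$.
   Context: A convergence structure on a set $X$ specifies, for each $x\in X$, which filters on $X$ converge to $x$, so that: (i) the principal ultrafilter of $x$ converges to $x$; (ii) if $\mathcal F\to x$ and $\mathcal F\subseteq\mathcal G$ then $\mathcal G\to x$; (iii) if $\mathcal F\to x$ and $\mathcal G\to x$ then $\mathcal F\cap\mathcal G\to x$. A net $(x_\alpha)$ converges to $x$ iff its tail filter (generated by the sets $\{x_\alpha : \alpha\ge\alpha_0\}$) converges to $x$; every filter is the tail filter of some net, so a convergence structure is determined by its convergent nets. It is Hausdorff if every net has at most one limit. A convergence structure on a vector space is linear if addition and scalar multiplication are jointly continuous (preserve convergence of nets). A linear convergence structure on a vector lattice is locally solid if $y_\alpha\to 0$ and $|x_\alpha|\le|y_\alpha|$ for every $\alpha$ imply $x_\alpha\to 0$. A net $(x_\alpha)_{\alpha\in A}$ is Cauchy if the double net $(x_\alpha-x_\beta)$ indexed by $A\times A$ converges to $0$; the structure is complete if every Cauchy net converges. For a locally solid convergence $\eta$ on a vector lattice $X$, its unbounded modification $\mathrm{u}\eta$ is defined by: $x_\alpha\to x$ in $\mathrm{u}\eta$ iff $|x_\alpha-x|\wedge u\to 0$ in $\eta$ for every $u\in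 X_+$. The restriction $\eta_{|J}$ is the convergence structure on the vector lattice $J$ in which a net of $J$ converges to a point of $J$ iff it does so in $(X,\eta)$; in $\mathrm{u}(\eta_{|J})$ the unbounded modification is taken in the vector lattice $J$, i.e. with $u$ ranging over $J_+$. The adherence $\overline{A}^{1}$ of a set $A\subseteq X$ is the set of all limits (in $\eta$) of convergent nets in $A$. A projection band is a band $B$ with $X=B\oplus B^d$. *)

(* Defs.v *)
From HB Require Import structures.
From mathcomp Require Import all_boot all_order all_algebra.
From mathcomp Require Import all_classical all_reals all_analysis.

Set Implicit Arguments.
Unset Strict Implicit.
Unset Printing Implicit Defensive.

Import Order.TTheory GRing.Theory Num.Theory.
Import numFieldNormedType.Exports.

Local Open Scope classical_set_scope.
Local Open Scope ring_scope.

(* [latticeType] cannot be joined with [lmodType] after [realDomainType] has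
   been declared, so binary infima and suprema are operations here, as the
   greatest lower and least upper bounds for [<=]. *)
HB.mixin Record Lmodule_POrder_isVectorLattice (R : realType) X
    of GRing.Lmodule R X & Order.POrder ring_display X := {
  vmeet : X -> X -> X;
  vjoin : X -> X -> X;
  vle_meet : forall x y z : X, (z <= vmeet x y) = (z <= x) && (z <= y);
  vjoin_le : forall x y z : X, (vjoin x y <= z) = (x <= z) && (y <= z);
  lev_add2r : forall z x y : X, x <= y -> x + z <= y + z;
  scalev_ge0 : forall (a : R) (x : X), 0 <= a -> 0 <= x -> 0 <= a *: x
}.

#[short(type="vectorLatticeType")]
HB.structure Definition VectorLattice (R : realType) :=
  { X of GRing.Lmodule R X & Order.POrder ring_display X
       & Lmodule_POrder_isVectorLattice R X }.

Section VectorLatticeDefs.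
Context {R : realType}.
Implicit Type X : vectorLatticeType R.

Definition modulus X (x : X) : X := vjoin x (- x).

Definition archimedean X :=
  forall x y : X, 0 <= x -> (forall n : nat, x *+ n <= y) -> x = 0.

Definition is_ideal X (A : set X) :=
  [/\ A 0,
      forall (a : R) (x y : X), A x -> A y -> A (a *: x + y)
    & forall x y : X, modulus x <= modulus y -> A y -> A x].

Definition disjoint_complement X (A : set X) : set X :=
  [set x | forall y, A y -> vmeet (modulus x) (modulus y) = 0].

Definition is_band X (B : set X) :=
  is_ideal B /\
  forall (A : set X) (s : X), A `<=` B -> supremums A s -> B s.

Definition is_projection_band X (B : set X) :=
  [/\ is_band B,
      forall x : X, exists y z, [/\ B y, disjoint_complement B z & x = y + z]
    & B `&` disjoint_complement B = [set 0]].

End VectorLatticeDefs.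

Record ideal (R : realType) (X : vectorLatticeType R) := Ideal {
  ideal_set :> set X;
  idealP : is_ideal ideal_set
}.

Section IdealVectorLattice.
Context {R : realType} {X : vectorLatticeType R} (J : ideal X).

Fact vjoin_ub (x y : X) : x <= vjoin x y /\ y <= vjoin x y.
Proof. by apply/andP; rewrite -vjoin_le. Qed.

Fact vmeet_lb (x y : X) : vmeet x y <= x /\ vmeet x y <= y.
Proof. by apply/andP; rewrite -vle_meet. Qed.

Fact lev_add (x y z t : X) : x <= y -> z <= t -> x + z <= y + t.
Proof.
move=> xy zt; apply: (le_trans (lev_add2r z x y xy)).
by rewrite ![y + _]addrC; exact: lev_add2r.
Qed.

Fact lev_opp (x y : X) : x <= y -> - y <= - x.
Proof.
by move=> /(lev_add2r (- x - y)); rewrite addrA subrr add0r addrCA subrr addr0.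
Qed.

Fact modulus_ge0 (x : X) : 0 <= modulus x.
Proof.
have h : 0 <= (2 : R) *: modulus x.
  rewrite scaler_nat mulr2n -(subrr x).
  by have [? ?] := vjoin_ub x (- x); exact: lev_add.
have := scalev_ge0 (2^-1 : R) _ _ h.
by rewrite scalerA mulVf ?pnatr_eq0// scale1r; apply; rewrite invr_ge0.
Qed.

Fact le_modulus (x : X) : x <= modulus x. Proof. by case: (vjoin_ub x (- x)). Qed.

Fact leN_modulus (x : X) : - modulus x <= x.
Proof. by rewrite -[leRHS]opprK; apply: lev_opp; case: (vjoin_ub x (- x)). Qed.

Fact ideal_between (x y z : X) : ideal_set J x -> ideal_set J y ->
  - (modulus x + modulus y) <= z -> z <= modulus x + modulus y -> ideal_set J z.
Proof.
have [J0 Jlin Jsol] := idealP J; move=> Jx Jy lz zu.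
have Jmod t : ideal_set J t -> ideal_set J (modulus t).
  apply: Jsol; rewrite {1}/modulus vjoin_le lexx /=.
  apply: le_trans (modulus_ge0 t).
  by rewrite -oppr0; apply: lev_opp; exact: modulus_ge0.
apply: (@Jsol z (modulus x + modulus y)).
  apply: le_trans (le_modulus _).
  by rewrite /modulus vjoin_le zu /= -[leRHS]opprK; exact: lev_opp.
by rewrite -[modulus x]scale1r; apply: Jlin; exact: Jmod.
Qed.

Fact modulus_bounds (x y : X) :
  [/\ x <= modulus x + modulus y, y <= modulus x + modulus y,
      - (modulus x + modulus y) <= x & - (modulus x + modulus y) <= y].
Proof.
have ux : modulus x <= modulus x + modulus y.
  by rewrite -[leLHS]addr0; apply: lev_add; rewrite ?modulus_ge0.
have uy : modulus y <= modulus x + modulus y.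
  by rewrite -[leLHS]add0r; apply: lev_add; rewrite ?modulus_ge0.
split.
- exact: le_trans (le_modulus x) ux.
- exact: le_trans (le_modulus y) uy.
- exact: le_trans (lev_opp ux) (leN_modulus x).
- exact: le_trans (lev_opp uy) (leN_modulus y).
Qed.

Definition ideal_pred : {pred X} := mem (ideal_set J).

Fact ideal_submod_closed : submod_closed ideal_pred.
Proof.
have [J0 Jlin _] := idealP J; split; first exact/mem_set.
by move=> a x y /set_mem Jx /set_mem Jy; exact/mem_set/Jlin.
Qed.

Fact ideal_meet_closed x y :
  x \in ideal_pred -> y \in ideal_pred -> vmeet x y \in ideal_pred.
Proof.
move=> /set_mem Jx /set_mem Jy; apply/mem_set.
have [? ? ? ?] := modulus_bounds x y.
apply: (ideal_between Jx Jy); first by rewrite vle_meet; exact/andP.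
by apply: (@le_trans _ _ x) => //; case: (vmeet_lb x y).
Qed.

Fact ideal_join_closed x y :
  x \in ideal_pred -> y \in ideal_pred -> vjoin x y \in ideal_pred.
Proof.
move=> /set_mem Jx /set_mem Jy; apply/mem_set.
have [? ? ? ?] := modulus_bounds x y.
apply: (ideal_between Jx Jy); last by rewrite vjoin_le; exact/andP.
by apply: (@le_trans _ _ x) => //; case: (vjoin_ub x y).
Qed.

HB.instance Definition _ :=
  GRing.isSubmodClosed.Build R X ideal_pred ideal_submod_closed.

Definition ideal_type := {x : X | x \in ideal_pred}.
HB.instance Definition _ := SubChoice.on ideal_type.
HB.instance Definition _ :=
  [SubChoice_isSubLmodule of ideal_type by <:].
HB.instance Definition _ :=
  [SubChoice_isSubPOrder of ideal_type by <: with ring_display].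

Definition ideal_meet (x y : ideal_type) : ideal_type :=
  exist (fun z => z \in ideal_pred) _ (ideal_meet_closed (valP x) (valP y)).

Definition ideal_join (x y : ideal_type) : ideal_type :=
  exist (fun z => z \in ideal_pred) _ (ideal_join_closed (valP x) (valP y)).

Fact ideal_le_meet x y z : (z <= ideal_meet x y) = (z <= x) && (z <= y).
Proof. by rewrite -!Order.le_val SubK vle_meet. Qed.

Fact ideal_join_le x y z : (ideal_join x y <= z) = (x <= z) && (y <= z).
Proof. by rewrite -!Order.le_val SubK vjoin_le. Qed.

Fact ideal_lev_add2r (z x y : ideal_type) : x <= y -> x + z <= y + z.
Proof. by rewrite -!Order.le_val !raddfD; exact: lev_add2r. Qed.

Fact ideal_scalev_ge0 (a : R) (x : ideal_type) :
  0 <= a -> 0 <= x -> 0 <= a *: x.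
Proof. by rewrite -!Order.le_val raddf0 linearZ; exact: scalev_ge0. Qed.

HB.instance Definition _ := Lmodule_POrder_isVectorLattice.Build R ideal_type
  ideal_le_meet ideal_join_le ideal_lev_add2r ideal_scalev_ge0.

End IdealVectorLattice.
Arguments ideal_type {R X} J.

Record directed_set := DirectedSet {
  dom :> Type;
  dle : dom -> dom -> Prop;
  dom_inhabited : inhabited dom;
  dle_refl : forall a, dle a a;
  dle_trans : forall a b c, dle a b -> dle b c -> dle a c;
  dle_directed : forall a b, exists c, dle a c /\ dle b c
}.

Section ProductDirected.
Variables A B : directed_set.
Let ple (p q : A * B) := dle p.1 q.1 /\ dle p.2 q.2.

Fact prod_inhabited : inhabited (A * B).
Proof. by case: (dom_inhabited A) (dom_inhabited B) => a [b]; split. Qed.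

Fact ple_refl p : ple p p. Proof. by split; exact: dle_refl. Qed.

Fact ple_trans p q r : ple p q -> ple q r -> ple p r.
Proof. by move=> [? ?] [? ?]; split; apply: dle_trans; eassumption. Qed.

Fact ple_directed p q : exists r, ple p r /\ ple q r.
Proof.
have [a [? ?]] := dle_directed p.1 q.1.
by have [b [? ?]] := dle_directed p.2 q.2; exists (a, b).
Qed.

Definition prod_directed :=
  DirectedSet prod_inhabited ple_refl ple_trans ple_directed.

End ProductDirected.

(* The filter generated by the tails of the net [x]. *)
Definition tail_filter (T : Type) (A : directed_set) (x : A -> T)
  : set_system T := [set P | exists a0, forall a, dle a0 a -> P (x a)].

Fact tail_filter_proper (T : Type) (A : directed_set) (x : A -> T) :
  ProperFilter (tail_filter x).
Proof.
split; first by move=> [a] /(_ a (dle_refl a)).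
split.
- by case: (dom_inhabited A) => a; exists a.
- move=> P Q [a Pa] [b Qb]; have [c [ac bc]] := dle_directed a b.
  by exists c => d cd; split; [apply: Pa | apply: Qb]; exact: dle_trans cd.
- by move=> P Q PQ [a Pa]; exists a => b /Pa /PQ.
Qed.

(* The relation lives on arbitrary set systems; [cvgs_proper] makes it hold
   only on proper filters, so that equality in [convergence T] is equality of
   the convergent filters. *)
Record convergence (T : Type) := Convergence {
  cvgs :> set_system T -> T -> Prop;
  cvgs_proper : forall F x, cvgs F x -> ProperFilter F;
  cvgs_point : forall x, cvgs (principal_filter x) x;
  cvgs_finer : forall F G x,
    ProperFilter G -> F `<=` G -> cvgs F x -> cvgs G x;
  cvgs_setI : forall F G x, cvgs F x -> cvgs G x -> cvgs (F `&` G) x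
}.

Definition net_cvg (T : Type) (eta : convergence T)
    (A : directed_set) (x : A -> T) (l : T) :=
  eta (tail_filter x) l.

Definition hausdorff (T : Type) (eta : convergence T) :=
  forall (A : directed_set) (x : A -> T) (l m : T),
    net_cvg eta x l -> net_cvg eta x m -> l = m.

Definition adherence (T : Type) (eta : convergence T) (S : set T) : set T :=
  [set l | exists (A : directed_set) (x : A -> T),
     (forall a, S (x a)) /\ net_cvg eta x l].

Fact proper_principal T (x : T) : ProperFilter (principal_filter x).
Proof.
split; first by move=> /(_ x erefl).
split=> //.
- by move=> P Q Px Qx y xy; split; [exact: Px | exact: Qx].
- by move=> P Q PQ Px y xy; exact/PQ/Px.
Qed.

Fact proper_setI T (F G : set_system T) :
  ProperFilter F -> ProperFilter G -> ProperFilter (F `&` G).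
Proof.
move=> FF GG; split; first by move=> [/filter_not_empty].
split; first by split; exact: filterT.
- by move=> P Q [? ?] [? ?]; split; exact: filterI.
- by move=> P Q PQ [? ?]; split; apply: filterS PQ _.
Qed.

Fact fmap_principal T U (f : T -> U) (x : T) :
  f @ principal_filter x = principal_filter (f x).
Proof.
by apply/seteqP; split=> P /= h y /= ->; exact: h.
Qed.

Section LinearConvergence.
Context {R : realType} {X : vectorLatticeType R} (eta : convergence X).

Definition linear_convergence :=
  (forall (A : directed_set) (x y : A -> X) (l m : X),
     net_cvg eta x l -> net_cvg eta y m ->
     net_cvg eta (fun a => x a + y a) (l + m)) /\
  (forall (A : directed_set) (r : A -> R) (x : A -> X) (c : R) (l : X),
     tail_filter r --> c -> net_cvg eta x l ->
     net_cvg eta (fun a => r a *: x a) (c *: l)).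

Definition locally_solid :=
  linear_convergence /\
  forall (A : directed_set) (x y : A -> X),
    net_cvg eta y 0 -> (forall a, modulus (x a) <= modulus (y a)) ->
    net_cvg eta x 0.

Definition cauchy_net (A : directed_set) (x : A -> X) :=
  @net_cvg X eta (prod_directed A A) (fun p => x p.1 - x p.2) 0.

Definition complete_convergence :=
  forall (A : directed_set) (x : A -> X), cauchy_net x ->
    exists l, net_cvg eta x l.

(* Stated for filters; [net_cvg_unbounded] below is the net formulation. *)
Definition unbounded_cvgs (F : set_system X) (x : X) :=
  ProperFilter F /\
  forall u : X, 0 <= u ->
    eta ((fun y => vmeet (modulus (y - x)) u) @ F) 0.

Fact unbounded_proper F x : unbounded_cvgs F x -> ProperFilter F.
Proof. by case. Qed.

Fact unbounded_point x : unbounded_cvgs (principal_filter x) x.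
Proof.
split=> [|u u0]; first exact: proper_principal.
have m0 : modulus (0 : X) = 0.
  by apply/eqP; rewrite eq_le modulus_ge0 vjoin_le oppr0 lexx.
have -> : 0 = vmeet (modulus (x - x)) u.
  by apply/eqP; rewrite eq_le subrr m0 vle_meet lexx u0/=; case: (vmeet_lb 0 u).
by rewrite fmap_principal; exact: cvgs_point.
Qed.

Fact unbounded_finer F G x :
  ProperFilter G -> F `<=` G -> unbounded_cvgs F x -> unbounded_cvgs G x.
Proof.
move=> GG FG [FF Fx]; split=> // u u0.
by apply: cvgs_finer (Fx u u0) => P; exact: FG.
Qed.

Fact unbounded_setI F G x :
  unbounded_cvgs F x -> unbounded_cvgs G x -> unbounded_cvgs (F `&` G) x.
Proof.
move=> [FF Fx] [GG Gx]; split=> [|u u0]; first exact: proper_setI.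
exact: cvgs_setI (Fx u u0) (Gx u u0).
Qed.

Definition unbounded : convergence X :=
  Convergence unbounded_proper unbounded_point unbounded_finer unbounded_setI.

Fact net_cvg_unbounded (A : directed_set) (x : A -> X) (l : X) :
  net_cvg unbounded x l <->
  forall u : X, 0 <= u ->
    net_cvg eta (fun a => vmeet (modulus (x a - l)) u) 0.
Proof.
by split=> [[_]|h]; last by split=> //; exact: tail_filter_proper.
Qed.

Variable J : ideal X.

(* Stated for filters; [net_cvg_restriction] below is the net formulation. *)
Definition restriction_cvgs (F : set_system (ideal_type J)) (x : ideal_type J) :=
  ProperFilter F /\ eta (\val @ F) (\val x).

Fact restriction_proper F x : restriction_cvgs F x -> ProperFilter F.
Proof. by case. Qed.

Fact restriction_point x : restriction_cvgs (principal_filter x) x.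
Proof.
split; first exact: proper_principal.
by rewrite fmap_principal; exact: cvgs_point.
Qed.

Fact restriction_finer F G x :
  ProperFilter G -> F `<=` G -> restriction_cvgs F x -> restriction_cvgs G x.
Proof.
move=> GG FG [FF Fx]; split=> //.
by apply: cvgs_finer Fx => P; exact: FG.
Qed.

Fact restriction_setI F G x :
  restriction_cvgs F x -> restriction_cvgs G x -> restriction_cvgs (F `&` G) x.
Proof.
move=> [FF Fx] [GG Gx]; split; first exact: proper_setI.
exact: cvgs_setI Fx Gx.
Qed.

Definition restriction : convergence (ideal_type J) :=
  Convergence restriction_proper restriction_point restriction_finer
    restriction_setI.

Fact net_cvg_restriction (A : directed_set) (x : A -> ideal_type J)
    (l : ideal_type J) :
  net_cvg restriction x l <-> net_cvg eta (fun a => \val (x a)) (\val l).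
Proof.
by split=> [[_]|h]; last by split=> //; exact: tail_filter_proper.
Qed.

End LinearConvergence.

(* Main.v *)
Require Import Defs.
From HB Require Import structures.
From mathcomp Require Import all_boot all_order all_algebra.
From mathcomp Require Import all_classical all_reals all_analysis.

(** Fix [x >= 0] and consider the set of all [j] in [J] with [0 <= j <= x],
  directed upwards, as an increasing net. If it converges, its limit [z] lies in
  the adherence of [J] and should be the component of [x] in the band generated
  by [J]. The whole theorem rests on the net being Cauchy.

  For [u >= 0] in [J], the net eventually passes the truncation [x /\ n u], and
  the defect [(x - x /\ n u) /\ u] is at most [x / n] (lemma
  [truncation_defect]). Two members [j], [k] beyond this truncation satisfy
  [|j - k| /\ u <= 2 x / n], so that the double net [j - k] converges to [0] in
  the unbounded modification computed inside [J] (lemma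
  [ideal_below_unbounded_cauchy]). The commutation hypothesis moves this
  convergence to the unbounded modification computed in [X], where [u = x] is
  allowed; since [|j - k| <= x], the truncation by [x] does nothing and the
  double net converges to [0] for [eta] itself (lemma [ideal_below_cauchy]).

  By completeness the net has a limit [z], and since [eta] is Hausdorff and
  locally solid, [j <= z <= x] for every member [j]. Thus [(x - z) /\ u] is below
  every defect, hence below [x / n] for all [n], and vanishes because [X] is
  Archimedean: [x - z] is disjoint from [J] (lemma [component_exists]).

  By linearity every element of [X] is the sum of an element of the adherence
  and an element of [J^d]. The adherence is contained in [J^dd], because the
  lattice operations are continuous (lemma [adherence_double_complement]).
  These two facts force it to be all of [J^dd], which is a band
  (lemma [disjoint_complement_band]). *)

Set Implicit Arguments.
Unset Strict Implicit.
Unset Printing Implicit Defensive.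

Import Order.TTheory GRing.Theory Num.Theory.
Import numFieldNormedType.Exports.

Local Open Scope classical_set_scope.
Local Open Scope ring_scope.

(** * Vector lattice inequalities *)

Section VectorLatticeTheory.
Context {R : realType} {X : vectorLatticeType R}.
Implicit Types (x y z u a b c : X) (n : nat).

Lemma vmeet_lel x y : vmeet x y <= x. Proof. by case: (vmeet_lb x y). Qed.
Lemma vmeet_ler x y : vmeet x y <= y. Proof. by case: (vmeet_lb x y). Qed.
Lemma vjoin_gel x y : x <= vjoin x y. Proof. by case: (vjoin_ub x y). Qed.
Lemma vjoin_ger x y : y <= vjoin x y. Proof. by case: (vjoin_ub x y). Qed.

Lemma le_vmeet z x y : z <= x -> z <= y -> z <= vmeet x y.
Proof. by rewrite vle_meet => -> ->. Qed.

Lemma vjoin_lub z x y : x <= z -> y <= z -> vjoin x y <= z.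
Proof. by rewrite vjoin_le => -> ->. Qed.

Lemma le_vmeet2 x y x' y' : x <= x' -> y <= y' -> vmeet x y <= vmeet x' y'.
Proof.
by move=> xx yy; apply: le_vmeet;
  [exact: le_trans (vmeet_lel _ _) xx|exact: le_trans (vmeet_ler _ _) yy].
Qed.

Lemma subv_ge0 x y : (0 <= y - x) = (x <= y).
Proof.
by apply/idP/idP => [/(lev_add2r x)|/(lev_add2r (- x))];
  rewrite ?subrr// add0r subrK.
Qed.

Lemma lev_subl_addr x y z : (x - y <= z) = (x <= z + y).
Proof. by rewrite -[x - y <= z]subv_ge0 -[x <= _]subv_ge0 opprB addrA. Qed.

Lemma lev_subr_addr x y z : (x <= y - z) = (x + z <= y).
Proof. by rewrite -[x <= _]subv_ge0 -[x + z <= y]subv_ge0 opprD addrAC addrA. Qed.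

Lemma addv_ge0 x y : 0 <= x -> 0 <= y -> 0 <= x + y.
Proof. by move=> x0 y0; rewrite -(addr0 0); exact: lev_add. Qed.

Lemma mulvn_ge0 n x : 0 <= x -> 0 <= x *+ n.
Proof. by move=> x0; elim: n => [|n ih]//; rewrite mulrSr addv_ge0. Qed.

Lemma lev_mulnr n x y : x <= y -> x *+ n <= y *+ n.
Proof. by move=> xy; rewrite -subv_ge0 -mulrnBl mulvn_ge0// subv_ge0. Qed.

Lemma modulus_lub z x : x <= z -> - x <= z -> modulus x <= z.
Proof. exact: vjoin_lub. Qed.

Lemma geN_modulus x : - x <= modulus x. Proof. exact: vjoin_ger. Qed.

Lemma modulusN x : modulus (- x) = modulus x.
Proof.
apply: le_anti; apply/andP; split; apply: modulus_lub;
  rewrite ?opprK ?le_modulus ?geN_modulus//.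
by rewrite -{1}[x]opprK; exact: geN_modulus.
Qed.

Lemma modulus_id x : 0 <= x -> modulus x = x.
Proof.
move=> x0; apply: le_anti; rewrite le_modulus andbT.
apply: modulus_lub => //; apply: (le_trans _ x0).
by rewrite -oppr0; exact: lev_opp.
Qed.

Lemma modulus_eq0 x : modulus x <= 0 -> x = 0.
Proof.
move=> x0; apply: le_anti; rewrite (le_trans (le_modulus x) x0)/=.
by apply: le_trans (leN_modulus x); rewrite -oppr0; exact: lev_opp.
Qed.

Lemma modulusD x y : modulus (x + y) <= modulus x + modulus y.
Proof.
apply: modulus_lub; rewrite ?opprD; apply: lev_add;
  by rewrite ?le_modulus ?geN_modulus.
Qed.

Lemma vmeetDl a b c : 0 <= a -> 0 <= b -> 0 <= c ->
  vmeet (a + b) c <= vmeet a c + vmeet b c.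
Proof.
move=> a0 b0 c0; set t := vmeet (a + b) c.
have tc : t <= c by exact: vmeet_ler.
rewrite addrC -lev_subl_addr; apply: le_vmeet; last first.
  rewrite lev_subl_addr; apply: le_trans tc _.
  by rewrite -[leLHS]addr0; apply: lev_add => //; exact: le_vmeet.
rewrite lev_subl_addr addrC -lev_subl_addr; apply: le_vmeet.
  by rewrite lev_subl_addr; exact: vmeet_lel.
by rewrite lev_subl_addr; apply: le_trans tc _;
  rewrite -[leLHS]addr0; exact: lev_add.
Qed.

Lemma vmeet_mulnl n a c : 0 <= a -> 0 <= c ->
  vmeet (a *+ n) c <= vmeet a c *+ n.
Proof.
move=> a0 c0; elim: n => [|n ih]; first by rewrite !mulr0n; exact: vmeet_lel.
rewrite !mulrSr; apply: le_trans (vmeetDl (mulvn_ge0 n a0) a0 c0) _.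
exact: lev_add.
Qed.

(** [x + y - z] is a lower bound of [x] and [y]. *)
Lemma addv_le_disjoint x y z : vmeet x y <= 0 -> x <= z -> y <= z -> x + y <= z.
Proof.
move=> xy xz yz; rewrite -subv_ge0 -[leRHS]opprK -oppr0 lev_opp//.
rewrite opprB; apply: le_trans xy; apply: le_vmeet.
  by rewrite lev_subl_addr lev_add.
by rewrite lev_subl_addr addrC lev_add.
Qed.

(** Each step from [x /\ k u] to [x /\ (k + 1) u] gains at least
  [(x - x /\ k u) /\ u], which decreases in [k]; the [n] gains below level [n]
  add up to at most [x]. *)
Lemma truncation_defect n x u : 0 <= x -> 0 <= u ->
  vmeet (x - vmeet x (u *+ n)) u *+ n <= x.
Proof.
move=> x0 u0; set w := vmeet _ _.
have wx : w <= x - vmeet x (u *+ n) by exact: vmeet_lel.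
have wu : w <= u by exact: vmeet_ler.
suff H k : (k <= n)%N -> w *+ k <= vmeet x (u *+ k).
  exact: le_trans (H n (leqnn n)) (vmeet_lel _ _).
elim: k => [_|k ih kn]; first by rewrite !mulr0n le_vmeet.
rewrite !mulrSr; apply: (@le_trans _ _ (vmeet x (u *+ k) + w)).
  by apply: lev_add => //; apply: ih; exact: ltnW.
apply: le_vmeet; last by apply: lev_add => //; exact: vmeet_ler.
rewrite addrC -lev_subr_addr; apply: le_trans wx _; apply: lev_add => //.
apply: lev_opp; apply: le_vmeet2 => //.
by rewrite -(subnK (ltnW kn)) mulrnDr -[leLHS]add0r; apply: lev_add => //;
  exact: mulvn_ge0.
Qed.

Lemma modulusZ_le (r : R) x : modulus (r *: x) <= `|r| *: modulus x.
Proof.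
have Z y z : y <= z -> `|r| *: y <= `|r| *: z.
  by move=> yz; rewrite -subv_ge0 -scalerBr scalev_ge0 ?subv_ge0.
have [r0|r0] := lerP 0 r.
  rewrite ger0_norm// in Z *.
  apply: modulus_lub; first exact/Z/le_modulus.
  by rewrite -scalerN; exact/Z/geN_modulus.
rewrite ltr0_norm// in Z *; apply: modulus_lub.
  by rewrite -[leLHS]opprK -scaleNr -scalerN; exact/Z/geN_modulus.
by rewrite -scaleNr; exact/Z/le_modulus.
Qed.

(** * Disjoint complements *)

Lemma disjointP (S : set X) x :
  (forall y, S y -> vmeet (modulus x) (modulus y) <= 0) ->
  disjoint_complement S x.
Proof.
move=> H y Sy; apply: le_anti; rewrite H//=.
by apply: le_vmeet; exact: modulus_ge0.
Qed.

Lemma disjoint_complement_ideal (S : set X) : is_ideal (disjoint_complement S).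
Proof.
split=> [|r x y Sx Sy|x y xy Sy]; apply: disjointP => z Sz.
- by rewrite modulus_id//; exact: vmeet_lel.
- pose n := Num.Def.archi_bound `|r|.
  have rn : `|r| <= n%:R by apply/ltW/archi_boundP.
  have rx : modulus (r *: x) <= modulus x *+ n.
    apply: le_trans (modulusZ_le r x) _.
    by rewrite -scaler_nat -subv_ge0 -scalerBl scalev_ge0 ?modulus_ge0 ?subr_ge0.
  have xy : modulus (r *: x + y) <= modulus x *+ n + modulus y.
    by apply: le_trans (modulusD _ _) _; exact: lev_add.
  apply: le_trans (le_vmeet2 xy (lexx (modulus z))) _.
  apply: le_trans (vmeetDl (mulvn_ge0 _ (modulus_ge0 _)) (modulus_ge0 _) (modulus_ge0 _)) _.
  rewrite Sy// addr0; apply: le_trans (vmeet_mulnl _ (modulus_ge0 _) (modulus_ge0 _)) _.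
  by rewrite Sx// mul0rn.
- by rewrite -(Sy z Sz); exact: le_vmeet2.
Qed.

(** For [A] disjoint from [y] with supremum [s], the part [c] of the positive
  part of [s] lying below [y] can be removed: the positive parts of the members
  of [A] are disjoint from [c], so that they still lie below [s^+ - c]. The
  negative part of [s] is below the modulus of any member of [A]. *)
Lemma disjoint_complement_band (S : set X) : is_band (disjoint_complement S).
Proof.
split=> [|A s AS [ubs lubs]]; first exact: disjoint_complement_ideal.
have [[a Aa]|A0] := pselect (exists a, A a); last first.
  have s_le y : s <= y by apply: lubs => a Aa; exfalso; apply: A0; exists a.
  suff -> : s = 0 by case: (disjoint_complement_ideal S).
  by apply: le_anti; rewrite s_le/= -[s](addrK s) subv_ge0 s_le.
apply: disjointP => y Sy; set sp := vjoin s 0; set c := vmeet sp (modulus y).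
have y0 := modulus_ge0 y.
have sp0 : 0 <= sp by exact: vjoin_ger.
have c0 : c <= 0.
  suff : sp <= sp - c by rewrite lev_subr_addr addrC -lev_subr_addr subrr.
  have spc : 0 <= sp - c by rewrite subv_ge0; exact: vmeet_lel.
  apply: vjoin_lub => //; apply: lubs => b Ab.
  apply: (@le_trans _ _ (vjoin b 0)); first exact: vjoin_gel.
  rewrite lev_subr_addr; apply: addv_le_disjoint.
  - rewrite -[leRHS](AS b Ab y Sy); apply: le_vmeet2; last exact: vmeet_ler.
    by apply: vjoin_lub; [exact: le_modulus|exact: modulus_ge0].
  - apply: vjoin_lub => //.
    by apply: le_trans (vjoin_gel s 0); exact: ubs.
  - exact: vmeet_lel.
have s_le : modulus s <= sp + modulus a.
  apply: modulus_lub.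
    rewrite -[leLHS]addr0; apply: lev_add; last exact: modulus_ge0.
    exact: vjoin_gel.
  rewrite -[leLHS]add0r; apply: lev_add => //.
  by apply: le_trans (geN_modulus a); apply: lev_opp; exact: ubs.
apply: le_trans (le_vmeet2 s_le (lexx _)) _.
apply: le_trans (vmeetDl sp0 (modulus_ge0 a) y0) _.
by rewrite (AS a Aa y Sy) addr0.
Qed.

Lemma vmeetC x y : vmeet x y = vmeet y x.
Proof.
by apply: le_anti; apply/andP; split; apply: le_vmeet;
  rewrite ?vmeet_lel ?vmeet_ler.
Qed.

Lemma disjoint_complement2 (S : set X) :
  S `<=` disjoint_complement (disjoint_complement S).
Proof. by move=> x Sx y Sy; rewrite vmeetC Sy. Qed.

Lemma disjoint_complementI (S : set X) x :
  S x -> disjoint_complement S x -> x = 0.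
Proof.
move=> Sx /(_ x Sx) H; apply: modulus_eq0.
by rewrite -[leRHS]H; exact: le_vmeet.
Qed.

(** If [x] in [S^dd] decomposes as [b + d] with [b] in [B] and [d] in [S^d], then
  [d = x - b] lies in [S^d] and in [S^dd], hence is [0]; so [B] is [S^dd]. *)
Lemma double_complement_projection_band (S B : set X) :
  B `<=` disjoint_complement (disjoint_complement S) ->
  (forall x, exists2 b, B b & disjoint_complement S (x - b)) ->
  is_projection_band B.
Proof.
move=> Bdd dec; set D := disjoint_complement S in Bdd dec.
have [_ Dlin _] := disjoint_complement_ideal D.
have -> : B = disjoint_complement D.
  apply/seteqP; split=> // x Dx; have [b Bb Db] := dec x.
  suff /eqP : x - b = 0 by rewrite subr_eq0 => /eqP ->.
  apply: (@disjoint_complementI D) => //.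
  by rewrite addrC -scaleN1r; apply: Dlin => //; exact: Bdd.
split; first exact: disjoint_complement_band.
  move=> x; have [b Bb Db] := dec x; exists b, (x - b).
  by split; [exact: Bdd|exact: disjoint_complement2|rewrite addrC subrK].
apply/seteqP; split=> [x [Dx DDx]|x ->]; first exact: disjoint_complementI DDx.
by split; case: (disjoint_complement_ideal D);
  case: (disjoint_complement_ideal (disjoint_complement D)).
Qed.

End VectorLatticeTheory.

(** * Locally solid convergences *)

Section LocallySolidTheory.
Context {R : realType} {X : vectorLatticeType R} (eta : convergence X).

Lemma net_cvg_finer (A B : directed_set) (x : A -> X) (y : B -> X) l :
  tail_filter x `<=` tail_filter y -> net_cvg eta x l -> net_cvg eta y l.
Proof. exact: cvgs_finer (tail_filter_proper y). Qed.

Lemma net_cvg_fst (A B : directed_set) (x : A -> X) l :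
  net_cvg eta x l -> net_cvg eta (fun p : prod_directed A B => x p.1) l.
Proof.
apply: net_cvg_finer => P [a0 Pa]; have [b0] := dom_inhabited B.
by exists (a0, b0) => p [/Pa].
Qed.

Lemma net_cvg_snd (A B : directed_set) (x : B -> X) l :
  net_cvg eta x l -> net_cvg eta (fun p : prod_directed A B => x p.2) l.
Proof.
apply: net_cvg_finer => P [b0 Pb]; have [a0] := dom_inhabited A.
by exists (a0, b0) => p [_ /Pb].
Qed.

Lemma net_cvg_const (A : directed_set) c :
  net_cvg eta (fun _ : A => c) c.
Proof.
apply: cvgs_finer (cvgs_point eta c); first exact: tail_filter_proper.
by move=> P Pc; have [a] := dom_inhabited A; exists a => b _; exact: Pc.
Qed.

Hypothesis hls : locally_solid eta.

Lemma net_cvgB (A : directed_set) (x y : A -> X) l m :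
  net_cvg eta x l -> net_cvg eta y m ->
  net_cvg eta (fun a => x a - y a) (l - m).
Proof.
case: hls => -[cvgD cvgZ] _ xl ym; apply: cvgD => //.
rewrite -scaleN1r.
have -> : (fun a => - y a) = (fun a => (-1 : R) *: y a).
  by apply/funext => a; rewrite scaleN1r.
apply: (cvgZ _ (fun=> -1)) => //.
move=> P /= /nbhs_singleton P1; have [a] := dom_inhabited A.
by exists a.
Qed.

(** Local solidity asks for domination at every index. Replacing the net by [0] at
  the indices not beyond [a0] secures this without changing its late tails. *)
Lemma net_cvg0_dominated (A : directed_set) (x y : A -> X) (a0 : A) :
  net_cvg eta y 0 ->
  (forall a, dle a0 a -> modulus (x a) <= modulus (y a)) ->
  net_cvg eta x 0.
Proof.
move=> y0 xy; pose x' a := if pselect (dle a0 a) then x a else 0.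
apply: (@net_cvg_finer A A x').
  move=> P [a1 Pa]; have [a2 [a02 a12]] := dle_directed a0 a1.
  exists a2 => a a2a; have := Pa a (dle_trans a12 a2a).
  by rewrite /x'; case: pselect => //; case; exact: dle_trans a2a.
apply: (hls.2 _ _ _ y0) => a; rewrite /x'; case: pselect => [|b] /=; first exact: xy.
by rewrite modulus_id//; exact: modulus_ge0.
Qed.

Lemma adherenceB (S : set X) :
  (forall s t, S s -> S t -> S (s - t)) ->
  forall x y, adherence eta S x -> adherence eta S y -> adherence eta S (x - y).
Proof.
move=> SB x y [A [s [Ss sx]]] [B [t [St ty]]].
exists (prod_directed A B), (fun p => s p.1 - t p.2).
split=> [p|]; first exact: SB.
by apply: net_cvgB; [exact: net_cvg_fst|exact: net_cvg_snd].
Qed.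

Section RelativelyUniform.
Variables (x : X) (x0 : 0 <= x).

Let index := {p : nat * X | modulus p.2 *+ p.1.+1 <= x}.
Let index_le (p q : index) := ((sval p).1 <= (sval q).1)%N.

Fact index0 n : modulus (0 : X) *+ n.+1 <= x.
Proof. by rewrite modulus_id// mul0rn. Qed.

Fact index_inhabited : inhabited index.
Proof. by split; exists (0%N, 0); exact: index0. Qed.

Fact index_directed p q : exists r, index_le p r /\ index_le q r.
Proof.
exists (exist _ (maxn (sval p).1 (sval q).1, 0) (index0 _)).
by rewrite /index_le/= leq_maxl leq_maxr.
Qed.

(** The net [(n, y) |-> y] on this index set has the order intervals
  [[- x / (n + 1), x / (n + 1)]] as its tails, so that every net eventually
  inside each of these intervals has a finer tail filter. Recording [n] in the
  index gives the scalars [1 / (n + 1)] that witness domination. *)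
Definition uniform_index := DirectedSet index_inhabited
  (fun p => leqnn (sval p).1) (fun p q r => @leq_trans _ _ _) index_directed.

Lemma uniform_index_cvg0 :
  net_cvg eta (fun p : uniform_index => (sval p).2) 0.
Proof.
have [[_ cvgZ] solid] := hls.
apply: (solid _ _ (fun p : uniform_index => harmonic (sval p).1 *: x)).
  rewrite -(scale0r x); apply: cvgZ; last exact: net_cvg_const.
  move=> P /(@cvg_harmonic R) [N _ NP].
  exists (exist _ (N, 0) (index0 N)) => p Np; exact: NP.
move=> [[n y] /= yx].
have h0 : 0 <= (n.+1%:R^-1 : R) by rewrite invr_ge0.
rewrite (modulus_id (scalev_ge0 _ _ h0 x0)).
rewrite -subv_ge0 in yx; rewrite -subv_ge0.
have := scalev_ge0 _ _ h0 yx.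
by rewrite scalerBr -[modulus y *+ _]scaler_nat scalerA mulVf ?pnatr_eq0// scale1r.
Qed.

Lemma relatively_uniform_cvg0 (A : directed_set) (y : A -> X) :
  (forall n, exists a0, forall a, dle a0 a -> modulus (y a) *+ n <= x) ->
  net_cvg eta y 0.
Proof.
move=> small; apply: net_cvg_finer uniform_index_cvg0 => P [[[n z] zx] Pn].
have [a0 ya] := small n.+1; exists a0 => a /ya yax.
by have := Pn (exist _ (n, y a) yax) (leqnn n).
Qed.

End RelativelyUniform.

Hypothesis hH : hausdorff eta.

(** The constant net [c] is dominated by [x_a - l], so it converges to [0] as well
  as to [c]. *)
Lemma limit_gap_eq0 (A : directed_set) (x : A -> X) (l c : X) (a0 : A) :
  net_cvg eta x l ->
  (forall a, dle a0 a -> modulus c <= modulus (x a - l)) -> c = 0.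
Proof.
move=> xl cx; have := net_cvgB xl (@net_cvg_const A l); rewrite subrr => xl0.
apply: hH (@net_cvg_const A c) _.
exact: (@net_cvg0_dominated A _ _ a0 xl0).
Qed.

Lemma le_limit (A : directed_set) (x : A -> X) (l m : X) (a0 : A) :
  net_cvg eta x l -> (forall a, dle a0 a -> m <= x a) -> m <= l.
Proof.
move=> xl mx; suff d0 : vjoin (m - l) 0 = 0.
  by rewrite -subv_ge0 -opprB -oppr0 lev_opp// -d0; exact: vjoin_gel.
apply: (limit_gap_eq0 (a0 := a0) xl) => a a0a.
rewrite modulus_id; last exact: vjoin_ger.
apply: vjoin_lub; last exact: modulus_ge0.
by apply: le_trans (le_modulus _); apply: lev_add => //; exact: mx.
Qed.

Lemma limit_le (A : directed_set) (x : A -> X) (l m : X) :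
  net_cvg eta x l -> (forall a, x a <= m) -> l <= m.
Proof.
move=> xl xm; suff d0 : vjoin (l - m) 0 = 0.
  by rewrite -subv_ge0 -opprB -oppr0 lev_opp// -d0; exact: vjoin_gel.
have [a0] := dom_inhabited A.
apply: (limit_gap_eq0 (a0 := a0) xl) => a a0a.
rewrite modulus_id; last exact: vjoin_ger.
apply: vjoin_lub; last exact: modulus_ge0.
by apply: le_trans (geN_modulus _); rewrite opprB lev_add// lev_opp.
Qed.

(** For [d] disjoint from a net [x_a] with limit [x], one has
  [|x| /\ |d| <= |x_a - x| /\ |d| + |x_a| /\ |d| <= |x_a - x|]. *)
Lemma adherence_double_complement (S : set X) :
  adherence eta S `<=` disjoint_complement (disjoint_complement S).
Proof.
move=> x [A [s [Ss sx]]] d Sd; have [a0] := dom_inhabited A.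
apply: (limit_gap_eq0 (a0 := a0) sx) => a _.
have d0 := modulus_ge0 d.
rewrite modulus_id; last by apply: le_vmeet => //; exact: modulus_ge0.
have xle : modulus x <= modulus (s a - x) + modulus (s a).
  rewrite -(modulusN (s a - x)); apply: le_trans (modulusD _ _).
  by rewrite opprB subrK.
apply: le_trans (le_vmeet2 xle (lexx _)) _.
apply: le_trans (vmeetDl (modulus_ge0 _) (modulus_ge0 _) d0) _.
by rewrite [vmeet (modulus (s a)) _]vmeetC Sd// addr0; exact: vmeet_lel.
Qed.

End LocallySolidTheory.

(** * Components in the adherence of an ideal *)

Section Component.
Context {R : realType} {X : vectorLatticeType R} (J : ideal X) (x : X).
Hypothesis x0 : 0 <= x.

Let below := {j : ideal_type J | (0 <= \val j) && (\val j <= x)}.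
Let elt (a : below) : X := \val (sval a).
Let below_le (a b : below) := elt a <= elt b.

Fact below_inhabited : inhabited below.
Proof. by split; exists 0; rewrite lexx x0. Qed.

Fact below_join (a b : below) :
  (0 <= \val (vjoin (sval a) (sval b))) && (\val (vjoin (sval a) (sval b)) <= x).
Proof.
case: a b => [j /andP[j0 jx]] [k /andP[k0 kx]] /=.
by rewrite vjoin_le jx kx (le_trans j0 (vjoin_gel _ _)).
Qed.

Fact below_directed a b : exists c, below_le a c /\ below_le b c.
Proof.
exists (exist (fun j : ideal_type J => (0 <= \val j) && (\val j <= x)) _
  (below_join a b)).
by split; [exact: vjoin_gel|exact: vjoin_ger].
Qed.

Definition ideal_below := DirectedSet below_inhabited
  (fun a => lexx (elt a)) (fun a b c => @le_trans _ _ _ _ _) below_directed.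

Let net (a : ideal_below) : X := elt a.

Lemma ideal_below_bounds a : 0 <= net a <= x.
Proof. exact: (svalP a). Qed.

Lemma ideal_belowI j : ideal_set J j -> 0 <= j -> j <= x -> exists a, net a = j.
Proof.
move=> Jj j0 jx; have Jj' : j \in ideal_pred J by exact/mem_set.
by have jb : (0 <= j) && (j <= x) by [rewrite j0|];
  exists (exist _ (exist _ j Jj') jb).
Qed.

Lemma ideal_below_truncation n u : ideal_set J u -> 0 <= u ->
  exists a0, net a0 = vmeet x (u *+ n).
Proof.
move=> Ju u0; have [J0 Jlin Jsol] := idealP J.
have un0 := mulvn_ge0 n u0.
have t0 : 0 <= vmeet x (u *+ n) by exact: le_vmeet.
apply: ideal_belowI => //; last exact: vmeet_lel.
apply: (Jsol _ (u *+ n)).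
  by rewrite !modulus_id//; exact: vmeet_ler.
by rewrite -scaler_nat -[_ *: u]addr0; exact: Jlin.
Qed.

Lemma ideal_below_defect n u : ideal_set J u -> 0 <= u ->
  exists a0, forall a, dle a0 a -> vmeet (x - net a) u *+ n <= x.
Proof.
move=> Ju u0; have [a0 a0E] := ideal_below_truncation n Ju u0.
exists a0 => a a0a; apply: le_trans (truncation_defect n x0 u0).
apply: lev_mulnr; apply: le_vmeet2 => //; apply: lev_add => //.
by apply: lev_opp; rewrite -a0E.
Qed.

(** [|j - k| <= (x - j) + (x - k)], and each summand has a small defect. *)
Lemma ideal_below_gap n u : ideal_set J u -> 0 <= u ->
  exists p0, forall p : prod_directed ideal_below ideal_below, dle p0 p ->
    vmeet (modulus (net p.1 - net p.2)) u *+ n <= x + x.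
Proof.
move=> Ju u0; have [a0 Ha] := ideal_below_defect n Ju u0.
exists (a0, a0) => -[a b] [/= /Ha da /Ha db].
have [/andP[_ ax] /andP[_ bx]] := (ideal_below_bounds a, ideal_below_bounds b).
apply: le_trans (lev_add da db); rewrite -mulrnDl; apply: lev_mulnr.
apply: le_trans (vmeetDl _ _ u0); rewrite ?subv_ge0//.
apply: le_vmeet2 => //.
rewrite -[net a - net b](subrKA x).
apply: le_trans (modulusD _ _) _.
by rewrite -modulusN opprB !modulus_id ?subv_ge0.
Qed.

Context (eta : convergence X) (hls : locally_solid eta).

(** The gaps are uniformly small relative to [2 x], for every truncation by an
  element of [J]; elements of [X] outside [J] are out of reach here. *)
Lemma ideal_below_unbounded_cauchy :
  net_cvg (unbounded (restriction eta J))
    (fun p : prod_directed ideal_below ideal_below => sval p.1 - sval p.2) 0.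
Proof.
apply/net_cvg_unbounded => u u0; apply/net_cvg_restriction.
have xx0 : 0 <= x + x by exact: addv_ge0.
apply: (relatively_uniform_cvg0 hls xx0) => n.
have [p0 H] := ideal_below_gap n (set_mem (valP u)) u0; exists p0 => p /H.
rewrite subr0 [modulus (\val _)]modulus_id//.
by apply: le_vmeet; [exact: modulus_ge0|exact: u0].
Qed.

Hypothesis hcomm :
  restriction (unbounded eta) J = unbounded (restriction eta J).

(** The commutation hypothesis permits truncation by [x] itself, and
  [|j - k| /\ x = |j - k|]. *)
Lemma ideal_below_cauchy : cauchy_net eta net.
Proof.
have := ideal_below_unbounded_cauchy; rewrite -hcomm.
move=> /net_cvg_restriction /net_cvg_unbounded /(_ x x0) H.
have [p0] := dom_inhabited (prod_directed ideal_below ideal_below).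
apply: (net_cvg0_dominated hls (a0 := p0) H) => -[a b] _ /=.
have [/andP[a0 ax] /andP[b0 bx]] := (ideal_below_bounds a, ideal_below_bounds b).
rewrite [leRHS]modulus_id; last by apply: le_vmeet => //; exact: modulus_ge0.
rewrite subr0; apply: le_vmeet => //.
apply: modulus_lub; rewrite ?opprB -[leRHS]addr0; apply: lev_add => //;
  by rewrite -oppr0; exact: lev_opp.
Qed.

Hypotheses (hX : archimedean X) (hH : hausdorff eta).
Hypothesis hC : complete_convergence eta.

(** The limit [z] of the net dominates all its members, so [x - z] inherits their
  vanishing defects. *)
Lemma component_exists :
  exists2 z, adherence eta J z & disjoint_complement J (x - z).
Proof.
have [z netz] := hC ideal_below_cauchy.
exists z; first by exists ideal_below, net; split=> // a; exact/set_mem/valP.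
have zx : z <= x.
  by apply: limit_le netz _ => // a; case/andP: (ideal_below_bounds a).
have net_le a : net a <= z by exact: (le_limit hls hH (a0 := a) netz).
have d0 : 0 <= x - z by rewrite subv_ge0.
move=> y Jy; have y0 := modulus_ge0 y.
have Jmy : ideal_set J (modulus y).
  have [_ _ Jsol] := idealP J.
  by apply: (Jsol _ y) => //; rewrite [leLHS]modulus_id.
rewrite modulus_id//; apply: (hX (y := x)); first exact: le_vmeet.
move=> n; have [a0 H] := ideal_below_defect n Jmy y0.
apply: le_trans (H a0 (dle_refl a0)); apply: lev_mulnr.
by apply: le_vmeet2 => //; apply: lev_add => //; exact: lev_opp.
Qed.

End Component.

Theorem theorem11p7 (R : realType) (X : vectorLatticeType R)
    (eta : convergence X) (J : ideal X)
    (hX : archimedean X)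
    (hls : locally_solid eta)
    (hH : hausdorff eta)
    (hC : complete_convergence eta)
    (hcomm : restriction (unbounded eta) J = unbounded (restriction eta J)) :
  is_projection_band (adherence eta J).
Proof.
apply: (@double_complement_projection_band _ _ J).
  exact: adherence_double_complement.
move=> x; have [J0 Jlin _] := idealP J.
have [_ Dlin _] := disjoint_complement_ideal J.
have xp0 : 0 <= vjoin x 0 by exact: vjoin_ger.
have xn0 : 0 <= vjoin x 0 - x by rewrite subv_ge0; exact: vjoin_gel.
have [b Bb Db] := component_exists xp0 hls hcomm hX hH hC.
have [c Bc Dc] := component_exists xn0 hls hcomm hX hH hC.
(* [b] and [c] are the components of the positive part of [x] and of its negative
   part, the latter written [vjoin x 0 - x]. *)
exists (b - c).
  apply: (adherenceB hls) => // s t Js Jt.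
  by rewrite addrC -scaleN1r; exact: Jlin.
have -> : x - (b - c) = (-1) *: (vjoin x 0 - x - c) + (vjoin x 0 - b).
  by rewrite scaleN1r !opprB -[RHS]addrA subrKA [RHS]addrCA.
exact: Dlin.
Qed.
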